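(* Let $\mathcal{T}_1,\mathcal{T}_2\in\mathbf{HC}(\mathbb{S}^d)$ be two hyper projection operators. Then the difference $\mathcal{T}_2-\mathcal{T}_1$ is a hyper projection operator if and only if $\mathcal{T}_1$ is a suboperator of $\mathcal{T}_2$.
   Context: Let $d\ge2$ and let $\mathbb{S}^d\subset\mathbb{R}^{d+1}$ be the unit sphere with Lebesgue surface measure $\mathrm{d}\omega_d$. $\mathcal{C}(\mathbb{S}^d)$ is the space of real continuous functions on $\mathbb{S}^d$; $\mathbb{P}_n(\mathbb{S}^d)$ is the space of restrictions to $\mathbb{S}^d$ of real polynomials of total degree at most $n$. For each $\ell\ge0$, $\{Y^{(d)}_{\ell k}:k=1,\dots,Z(d,\ell)\}$ is a fixed real $L_2(\mathbb{S}^d)$-orthonormal basis of the space of real spherical harmonics of degree $\ell$ (restrictions to $\mathbb{S}^d$ of real harmonic homogeneous polynomials of degree $\ell$), whose dimension is $Z(d,\ell)$. Fix a quadrature rule with nodes $\mathbf{x}_1,\dots,\mathbf{x}_N\in\mathbb{S}^d$ and positive weights $w_1,\dots,w_N$. It has exactness $m$ if $\sum_{j=1}^N w_jp(\mathbf{x}_j)=\int_{\mathbb{S}^d}p\,\mathrm{d}\omega_d$ for all $p\in\mathbb{P}_m(\mathbb{S}^d)$. Put $\langle f,g\rangle_N=\sum_{j=1}^N w_jf(\mathbf{x}_j)g(\mathbf{x}_j)$ for $f,g\in\mathcal{C}(\mathbb{S}^d)$. Hyperinterpolation class $\mathbf{HC}(\mathbb{S}^d)$: the operators $\mathcal{T}:\mathcal{C}(\mathbb{S}^d)\to\mathbb{P}_n(\mathbb{S}^d)$,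 for some $n$ such that the quadrature rule has exactness $2n$, of the form $\mathcal{T}f=\sum_{\ell=0}^n\sum_{k=1}^{Z(d,\ell)}\Phi\big(\langle f,Y^{(d)}_{\ell k}\rangle_N\big)Y^{(d)}_{\ell k}$, where $\Phi:\mathbb{R}\to\mathbb{R}$ is a (possibly nonlinear, possibly $(\ell,k)$-dependent) function, for which there exists $c_d>0$, independent of $n$, with $\|\mathcal{T}f\|_{L_2(\mathbb{S}^d)}\le c_d\|f\|_\infty$ for all $f\in\mathcal{C}(\mathbb{S}^d)$. (For a single operator this is the existence of a finite constant; independence of $n$ concerns families indexed by $n$.) Different operators may have different degrees $n$; the quadrature rule is the same. Operators are composed, added and subtracted as maps $\mathcal{C}(\mathbb{S}^d)\to\mathcal{C}(\mathbb{S}^d)$. An operator $\mathcal{T}$ on $\mathcal{C}(\mathbb{S}^d)$ is hyper self-adjoint if $\langle\mathcal{T}f,g\rangle_N=\langle f,\mathcal{T}g\rangle_N$ for all $f,g\in\mathcal{C}(\mathbb{S}^d)$. It is a hyper projection operator if it is hyper self-adjoint and $\mathcal{T}^2=\mathcal{T}$. For hyper projection operators $\mathcal{T}_1,\mathcal{T}_2$, $\mathcal{T}_1$ is a suboperator of $\mathcal{T}_2$ if the image of $\mathcal{T}_1$ is contained in the image of $\mathcal{T}_2$. *)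

(* Defs.v *)
From HB Require Import structures.
From mathcomp Require Import all_boot all_order all_algebra.
From mathcomp Require mpoly.

Set Implicit Arguments.
Unset Strict Implicit.
Unset Printing Implicit Defensive.

Import Order.TTheory GRing.Theory Num.Theory.
Local Open Scope ring_scope.

(* The notations of mpoly clash with those of the analysis libraries, hence an
   import that is local to this module and precedes them. *)
Module SpherePoly.
Import mpoly.
Section Def.
Variables (R : comNzRingType) (n : nat).
Implicit Types p : {mpoly R[n]}.

(* msize is 1 + the total degree, and 0 for the zero polynomial. *)
Definition deg_le (m : nat) p : Prop := (msize p <= m.+1)%N.

Definition homogeneous (l : nat) p : Prop := p \is l.-homog.

Definition harmonic p : Prop := \sum_(i < n) mderiv i (mderiv i p) = 0.

Definition eval p (x : 'rV[R]_n) : R := p.@[fun i => x 0 i].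

End Def.
End SpherePoly.

From mathcomp Require Import all_classical all_reals all_analysis.
From mathcomp Require Import measurable_realfun.
Import numFieldNormedType.Exports.
Local Open Scope classical_set_scope.

(* Product measures are binary in the library; Lebesgue measure on R^n, seen as
   n.-tuple R, is their iteration. *)
Section lebesgue_tuple.
Context {R : realType}.
Local Notation T n := (n.-tuple (measurableTypeR R)).

Definition tuple_cons n (z : measurableTypeR R * T n) : T n.+1 :=
  [tuple of z.1 :: z.2].

Let measurable_tuple_cons n : measurable_fun setT (@tuple_cons n).
Proof. by apply: measurable_cons; [exact: measurable_fst|exact: measurable_snd]. Qed.

HB.instance Definition _ n :=
  @isMeasurableFun.Build _ _ _ _ (@tuple_cons n) (@measurable_tuple_cons n).

Let tuple_uncons n (t : T n.+1) : measurableTypeR R * T n :=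
  (tnth t ord0, [tuple of behead t]).

Let tuple_consK n : cancel (@tuple_cons n) (@tuple_uncons n).
Proof.
by move=> [x t]; rewrite /tuple_uncons /tuple_cons /=; congr pair; exact/val_inj.
Qed.

Let measurable_tuple_uncons n : measurable_fun setT (@tuple_uncons n).
Proof.
apply/measurable_fun_pairP; split; first exact: measurable_tnth.
exact: measurable_behead.
Qed.

Section step.
Variables (n : nat) (mu : {sigma_finite_measure set (T n) -> \bar R}).

Definition lebesgue_cons : set (T n.+1) -> \bar R :=
  pushforward (lebesgue_measure \x mu)%E (@tuple_cons n).

Let lebesgue_cons0 : lebesgue_cons set0 = 0%E.
Proof. exact: measure0. Qed.

Let lebesgue_cons_ge0 A : (0 <= lebesgue_cons A)%E.
Proof. exact: measure_ge0. Qed.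

Let lebesgue_cons_sigma_additive : semi_sigma_additive lebesgue_cons.
Proof. exact: measure_semi_sigma_additive. Qed.

HB.instance Definition _ := isMeasure.Build _ _ _ lebesgue_cons
  lebesgue_cons0 lebesgue_cons_ge0 lebesgue_cons_sigma_additive.

Let lebesgue_cons_sigma_finite : sigma_finite setT lebesgue_cons.
Proof.
have /sigma_finiteP[F [TF ndF Foo]] := sigma_finiteT (@lebesgue_measure R).
have /sigma_finiteP[G [TG ndG Goo]] := sigma_finiteT mu.
exists (fun k => @tuple_uncons n @^-1` (F k `*` G k)).
  rewrite -preimage_bigcup -[LHS](preimage_setT (@tuple_uncons n)).
  congr (_ @^-1` _); rewrite -setXTT TF TG; apply/seteqP; split => -[x y].
    move=> [/= [i _ Fix] [j _ Gjy]]; exists (maxn i j) => //; split.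
    - by move: x Fix; exact/subsetPset/ndF/leq_maxl.
    - by move: y Gjy; exact/subsetPset/ndG/leq_maxr.
  by move=> [k _ []/= ? ?]; split; exists k.
move=> k; have [? ?] := Foo k; have [? ?] := Goo k; split.
  rewrite -[X in measurable X]setTI; apply: measurable_tuple_uncons => //.
  exact: measurableX.
rewrite /lebesgue_cons /pushforward -comp_preimage.
rewrite (_ : _ \o _ = id) ?preimage_id; last first.
  by apply/funext => z /=; exact: tuple_consK.
by rewrite product_measure1E// lte_mul_pinfty// ge0_fin_numE.
Qed.

HB.instance Definition _ := Measure_isSigmaFinite.Build _ _ _ lebesgue_cons
  lebesgue_cons_sigma_finite.

End step.

Fixpoint lebesgue_tuple n : {sigma_finite_measure set (T n) -> \bar R} :=
  if n is n'.+1 then lebesgue_cons (lebesgue_tuple n') else \d_[tuple].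

End lebesgue_tuple.

Section sphere.
Variables (R : realType) (d : nat).

(* Euclidean: the norm of 'rV[R]_n in the library is the maximum norm. *)
Definition sphere : set 'rV[R]_d.+1 := [set x | \sum_i x 0 i ^+ 2 = 1].

Definition Sphere : Type := set_type sphere.

HB.instance Definition _ := SubChoice.on Sphere.
HB.instance Definition _ := Topological.copy Sphere (set_type sphere).

Definition coord (x : Sphere) (i : 'I_d.+1) : R := (val x : 'rV[R]_d.+1) 0 i.

Let pole_subproof : (\row_i (i == ord0)%:R : 'rV[R]_d.+1) \in sphere.
Proof.
rewrite inE /sphere/= (bigD1 ord0)//= mxE eqxx expr1n big1 ?addr0// => i i0.
by rewrite mxE (negbTE i0) expr0n.
Qed.

Definition pole : Sphere := exist (fun x => x \in sphere) _ pole_subproof.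

HB.instance Definition _ := isPointed.Build Sphere pole.

Definition sphere_display : measure_display.
Proof. exact: default_measure_display. Qed.

(* The trace of the Borel sigma-algebra of R^(d+1), generated by the
   coordinate functions as for n.-tuple R. *)
Definition sphere_measurable : set (set Sphere) :=
  g_sigma_preimage (fun i (x : Sphere) => coord x i : measurableTypeR R).

Let sphere_measurable0 : sphere_measurable set0.
Proof. exact: sigma_algebra0. Qed.

Let sphere_measurableC A : sphere_measurable A -> sphere_measurable (~` A).
Proof. exact: sigma_algebraC. Qed.

Let sphere_measurable_bigcup (F : (set Sphere)^nat) :
  (forall i, sphere_measurable (F i)) -> sphere_measurable (\bigcup_i (F i)).
Proof. exact: sigma_algebra_bigcup. Qed.

HB.instance Definition _ := @isMeasurable.Build sphere_display Sphere
  sphere_measurable sphere_measurable0 sphere_measurableC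
  sphere_measurable_bigcup.

Local Notation T := (d.+1.-tuple (measurableTypeR R)).

Definition sqnorm (t : T) : R := \sum_i tnth t i ^+ 2.

(* x / |x|, and pole at x = 0. *)
Definition radial_proj (t : T) : Sphere :=
  insubd pole (\row_i (tnth t i / Num.sqrt (sqnorm t))).

Definition punctured_ball : set T := [set t | 0 < sqnorm t <= 1].

Let measurable_sqnorm : measurable_fun setT (sqnorm : T -> measurableTypeR R).
Proof.
apply: measurable_sum => i; apply: measurable_funX; exact: measurable_tnth.
Qed.

Lemma measurable_punctured_ball : measurable punctured_ball.
Proof.
have -> : punctured_ball = sqnorm @^-1` `]0, 1].
  by apply/seteqP; split=> t /=; rewrite in_itv.
by rewrite -[X in measurable X]setTI; apply: measurable_sqnorm.
Qed.

Let coord_radial_proj t i : coord (radial_proj t) i =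
  if 0 < sqnorm t then tnth t i * sqnorm t `^ (- 2^-1) else coord pole i.
Proof.
have s0 : 0 <= sqnorm t by apply: sumr_ge0 => j _; exact: sqr_ge0.
rewrite /coord val_insubd powRN powR12_sqrt//.
have -> : ((\row_j (tnth t j / Num.sqrt (sqnorm t))) \in sphere)
          = (0 < sqnorm t).
  apply/idP/idP => [|s_gt0]; rewrite inE /sphere/=.
    rewrite lt_neqAle s0 andbT eq_sym; apply: contraPN => /eqP ->.
    under eq_bigr do rewrite mxE sqrtr0 invr0 mulr0 expr0n/=.
    by rewrite big1// => /esym/eqP; rewrite oner_eq0.
  under eq_bigr do rewrite mxE exprMn exprVn sqr_sqrtr//.
  by rewrite -mulr_suml -/(sqnorm t) divff// gt_eqF.
by case: ifPn => // _; rewrite mxE.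
Qed.

Let measurable_radial_proj : measurable_fun setT radial_proj.
Proof.
have coord_mble i :
    measurable_fun setT (fun t => coord (radial_proj t) i : measurableTypeR R).
  under eq_fun do rewrite coord_radial_proj.
  apply: measurable_fun_ifT.
  - exact: measurable_fun_ltr.
  - apply: measurable_funM; first exact: measurable_tnth.
    exact: (measurableT_comp (@measurable_powR R (- 2^-1)) measurable_sqnorm).
  - exact: measurable_cst.
suff : preimage_set_system setT radial_proj sphere_measurable `<=` measurable.
  by move=> sub _ A mA; apply: sub; exists A.
rewrite /sphere_measurable -g_sigma_preimage_comp.
apply: smallest_sub; first exact: sigma_algebra_measurable.
rewrite -bigcup_mkord_ord; apply: bigcup_sub => i _ A [B mB <-].
exact: coord_mble.
Qed.

HB.instance Definition _ :=
  @isMeasurableFun.Build _ _ _ _ radial_proj measurable_radial_proj.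

Definition cone_measure : set Sphere -> \bar R :=
  pushforward (mrestr (lebesgue_tuple d.+1) measurable_punctured_ball)
    radial_proj.

Let cone_measure0 : cone_measure set0 = 0%E.
Proof. exact: measure0. Qed.

Let cone_measure_ge0 A : (0 <= cone_measure A)%E.
Proof. exact: measure_ge0. Qed.

Let cone_measure_sigma_additive : semi_sigma_additive cone_measure.
Proof. exact: measure_semi_sigma_additive. Qed.

HB.instance Definition _ := isMeasure.Build _ _ _ cone_measure
  cone_measure0 cone_measure_ge0 cone_measure_sigma_additive.

(* By polar coordinates, the surface measure of A is d + 1 times the volume of
   the cone {r x | x in A, 0 < r <= 1}. *)
Definition surface_measure : set Sphere -> \bar R :=
  mscale d.+1%:R%:nng cone_measure.

HB.instance Definition _ := Measure.on surface_measure.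

End sphere.

Section continuous_zmodule.
Variables (X : topologicalType) (R : realType).
Local Notation C := (continuousType X R).
Implicit Types f g : C.

Let continuous_add f g : continuous (fun x => f x + g x).
Proof. by move=> x; apply: continuousD; exact: cts_fun. Qed.

Let continuous_opp f : continuous (fun x => - f x).
Proof. by move=> x; apply: continuousN; exact: cts_fun. Qed.

Let continuous_zero : continuous (fun _ : X => 0 : R).
Proof. by move=> x; exact: cst_continuous. Qed.

Let addC f g : C := mkcts (@continuous_add f g).
Let oppC f : C := mkcts (@continuous_opp f).
Let zeroC : C := mkcts continuous_zero.

Let addCA : associative addC.
Proof. by move=> f g h; apply/continuousEP => x; exact: addrA. Qed.

Let addCC : commutative addC.
Proof. by move=> f g; apply/continuousEP => x; exact: addrC. Qed.

Let add0C : left_id zeroC addC.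
Proof. by move=> f; apply/continuousEP => x; exact: add0r. Qed.

Let addNC : left_inverse zeroC oppC addC.
Proof. by move=> f; apply/continuousEP => x; exact: addNr. Qed.

HB.instance Definition _ := GRing.isZmodule.Build (continuousType X R)
  addCA addCC add0C addNC.

End continuous_zmodule.

Section hyperinterpolation.
Context {R : realType} {d : nat}.
Local Notation S := (Sphere R d).
Local Notation C := (continuousType S R).
Local Notation omega := (@surface_measure R d).

Definition polys (n : nat) : set (S -> R) :=
  [set f | exists2 p : mpoly.mpoly d.+1 R,
     SpherePoly.deg_le n p & forall x, f x = SpherePoly.eval p (val x)].

Definition spherical_harmonics (l : nat) : set (S -> R) :=
  [set f | exists p : mpoly.mpoly d.+1 R,
     [/\ SpherePoly.homogeneous l p, SpherePoly.harmonic p &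
         forall x, f x = SpherePoly.eval p (val x)]].

(* Z l is then the dimension of the space of harmonics of degree l. Nothing
   is required of Y l k and Y l' k' for distinct l and l'. *)
Definition orthonormal_basis (Z : nat -> nat)
    (Y : forall l, 'I_(Z l) -> C) : Prop :=
  forall l,
    [/\ forall k, spherical_harmonics l (Y l k),
        forall j k, (\int[omega]_x (Y l j x * Y l k x)%:E = (j == k)%:R%:E)%E &
        forall f, spherical_harmonics l f ->
          exists a : 'I_(Z l) -> R, forall x, f x = \sum_k a k * Y l k x].

Definition L2norm (f : C) : \bar R := ('N[omega]_2%:E [EFin \o f])%E.

Definition supnorm (f : C) : R := sup [set `|f x| | x in [set: S]].

Section quadrature.
Variables (N : nat) (x : 'I_N -> S) (w : 'I_N -> R).

Definition exactness (m : nat) : Prop := forall p, polys m p ->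
  (\int[omega]_y (p y)%:E = (\sum_j w j * p (x j))%:E)%E.

Definition inner (f g : C) : R := \sum_j w j * f (x j) * g (x j).

(* The independence of c from n concerns families of operators, and does not
   constrain a single one. *)
Definition hyper_class (Z : nat -> nat) (Y : forall l, 'I_(Z l) -> C)
    (T : C -> C) : Prop :=
  exists n : nat,
    [/\ exactness (2 * n),
        forall f, polys n (T f),
        exists Phi : forall l, 'I_(Z l) -> R -> R, forall f y,
          T f y = \sum_(l < n.+1) \sum_(k < Z l)
                    Phi l k (inner f (Y l k)) * Y l k y &
        exists2 c : R, 0 < c & forall f, (L2norm (T f) <= (c * supnorm f)%:E)%E].

Definition hyper_self_adjoint (T : C -> C) : Prop :=
  forall f g, inner (T f) g = inner f (T g).

Definition hyper_projection (T : C -> C) : Prop :=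
  hyper_self_adjoint T /\ T \o T = T.

End quadrature.

Definition suboperator (T1 T2 : C -> C) : Prop := range T1 `<=` range T2.

End hyperinterpolation.

(* Main.v *)
Require Import Defs.
From mathcomp Require Import all_boot all_order all_algebra.
From mathcomp Require mpoly.
Import Order.TTheory GRing.Theory Num.Theory.
Local Open Scope ring_scope.

(** An operator T of degree n is determined by discrete inner products, although
    the form <f, g>_N is only semidefinite on continuous functions. Indeed, on
    polynomials of degree at most n the form is definite: exactness 2n turns
    <p, p>_N into the integral of p^2 over the sphere, and this integral vanishes
    only for p = 0 ([polys_sqr_integral_eq0]), because the cone over the open set
    where p does not vanish contains a cube, whose Lebesgue measure is positive
    ([surface_measure_polys_gt0]). Hence two polynomials of degree at most n with
    the same inner products against all continuous functions coincide
    ([exact_inner_inj]).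

    It follows that a hyper self-adjoint T, possibly nonlinear a priori, is
    additive ([self_adjointB]): T (f - g) and T f - T g have the same inner
    products with every h, namely <f - g, T h>_N. The rule is exact for the larger
    of the two degrees, so that T1, T2 and T2 - T1 can be treated together, and
    the usual algebra of orthogonal projections applies.

    If the range of T1 lies in that of T2, then T2 T1 = T1, hence T1 T2 = T1 by
    taking adjoints, and T2 - T1 is idempotent. Conversely, idempotence of
    T2 - T1 means T1 T2 + T2 T1 = 2 T1; composing with T1 on the left and on the
    right gives T1 T2 = T2 T1, so that 2 T2 T1 = 2 T1 and T2 fixes the range of
    T1. *)

(** * Degrees of polynomials *)

(** The notations of multivariate polynomials clash with those of analysis; the
    module confines them. *)
Module SpherePolyTheory.
Import mpoly.

Lemma deg_leB {R : comNzRingType} {n m : nat} {p q : {mpoly R[n]}} :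
  SpherePoly.deg_le m p -> SpherePoly.deg_le m q -> SpherePoly.deg_le m (p - q).
Proof.
move=> pm qm; rewrite /SpherePoly.deg_le (leq_trans (msizeD_le _ _))// msizeN.
by rewrite geq_max; apply/andP.
Qed.

Lemma deg_leM {R : idomainType} {n k m : nat} {p q : {mpoly R[n]}} :
  SpherePoly.deg_le k p -> SpherePoly.deg_le m q ->
  SpherePoly.deg_le (k + m) (p * q).
Proof.
rewrite /SpherePoly.deg_le => pk qm.
have [->|p0] := eqVneq p 0; first by rewrite mul0r msize0.
have [->|q0] := eqVneq q 0; first by rewrite mulr0 msize0.
rewrite msizeM// -subn1 leq_subLR (leq_trans (leq_add pk qm))//.
by rewrite addSn addnS.
Qed.

Lemma evalB {R : comNzRingType} {n : nat} (p q : {mpoly R[n]}) (v : 'rV[R]_n) :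
  SpherePoly.eval (p - q) v = SpherePoly.eval p v - SpherePoly.eval q v.
Proof. exact: mevalB. Qed.

Lemma evalM {R : comNzRingType} {n : nat} (p q : {mpoly R[n]}) (v : 'rV[R]_n) :
  SpherePoly.eval (p * q) v = SpherePoly.eval p v * SpherePoly.eval q v.
Proof. exact: mevalM. Qed.

End SpherePolyTheory.

From mathcomp Require Import all_classical all_reals all_analysis.
From mathcomp Require Import measurable_realfun lra.
Import numFieldNormedType.Exports.
Local Open Scope classical_set_scope.

(** * Cubes have positive Lebesgue measure *)

Definition cube {R : realType} {n : nat} (c : 'I_n -> R) (r : R) :
    set (n.-tuple (measurableTypeR R)) :=
  [set t | forall i, ball (c i) r (tnth t i : R)].

Lemma measurable_cube {R : realType} {n : nat} (c : 'I_n -> R) (r : R) :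
  measurable (cube c r).
Proof.
have -> : cube c r =
    \bigcap_(i in [set: 'I_n]) ((@tnth n R)^~ i @^-1` ball (c i) r).
  by apply/seteqP; split => t ct i; [move=> _; exact: ct|exact: (ct i I)].
apply: fin_bigcap_measurable => // i _.
rewrite -[X in measurable X]setTI.
apply: (@measurable_tnth _ (measurableTypeR R)) => //.
exact: measurable_ball.
Qed.

Lemma lebesgue_tuple_cube_gt0 {R : realType} {n : nat} (c : 'I_n -> R) (r : R) :
  0 < r -> (0 < lebesgue_tuple n (cube c r))%E.
Proof.
move=> r0; elim: n c => [|n IH] c /=.
  by rewrite diracE mem_set ?lte01// => -[].
have preE : @tuple_cons R n @^-1` cube c r =
    ball (c ord0) r `*` cube (fun i => c (lift ord0 i)) r.
  apply/seteqP; split=> -[z t] /=.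
    move=> ct; split => [|i /=]; first exact: (ct ord0).
    by have := ct (lift ord0 i); rewrite tnthS.
  move=> [/= zr tr] i; case: (unliftP ord0 i) => [j|] ->; last exact: zr.
  by rewrite tnthS; exact: tr.
rewrite /lebesgue_cons /pushforward preE product_measure1E.
- apply: mule_gt0 => //.
  have := lebesgue_measure_ball (c ord0) (ltW r0).
  by move=> /= ->; rewrite lte_fin pmulrn_lgt0.
- exact: measurable_ball.
- exact: measurable_cube.
Qed.

(** * Continuity and measurability of polynomials *)

Lemma cvg_expr {R : realType} {T : Type} {F : set_system T} {FF : Filter F}
    (f : T -> R) (a : R) (k : nat) :
  f @ F --> a -> f t ^+ k @[t --> F] --> a ^+ k.
Proof. by move=> fa; exact: (cvg_comp _ _ fa (@exprn_continuous R k a)). Qed.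

Lemma cvg_meval {R : realType} {n : nat} {T : Type} {F : set_system T}
    {FF : Filter F} (f : 'I_n -> T -> R) (a : 'I_n -> R)
    (p : mpoly.mpoly n R) :
  (forall i, f i @ F --> a i) ->
  mpoly.meval (fun i => f i t) p @[t --> F] --> mpoly.meval a p.
Proof.
move=> fa; rewrite mpoly.mevalE.
under eq_fun do rewrite mpoly.mevalE.
apply: cvg_big => [|m _]; first exact: add_continuous.
apply: cvgM; first exact: cvg_cst.
apply: cvg_big => [|i _]; first exact: mul_continuous.
exact: cvg_expr.
Qed.

Lemma measurable_coord {R : realType} {d : nat} (i : 'I_d.+1) :
  measurable_fun setT
    (fun s : Sphere R d => Defs.coord s i : measurableTypeR R).
Proof.
move=> _ A mA; rewrite setTI; apply: sub_sigma_algebra.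
rewrite -bigcup_mkord_ord; exists i; first exact: ltn_ord.
exists A => //; rewrite setTI.
congr (_ @^-1` A); apply/funext => s; congr Defs.coord.
by apply/val_inj; rewrite /= inordK.
Qed.

Lemma measurable_polys {R : realType} {d n : nat} {f : Sphere R d -> R} :
  polys n f -> measurable_fun setT f.
Proof.
move=> [p _ fE].
rewrite (_ : f = fun s => SpherePoly.eval p (val s)); last exact/funext.
rewrite /SpherePoly.eval; under eq_fun do rewrite mpoly.mevalE.
apply: measurable_sum => m; apply: measurable_funM => //.
apply: measurable_prod => i _; apply: measurable_funX.
exact: measurable_coord.
Qed.

Lemma polysB {R : realType} {d n : nat} {f g : Sphere R d -> R} :
  polys n f -> polys n g -> polys n (fun y => f y - g y).
Proof.
move=> [p pn fE] [q qn gE].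
refine (ex_intro2 _ _ _ (SpherePolyTheory.deg_leB pn qn) _).
by move=> y; rewrite SpherePolyTheory.evalB fE gE.
Qed.

Lemma polysM {R : realType} {d m n : nat} {f g : Sphere R d -> R} :
  polys m f -> polys n g -> polys (m + n) (fun y => f y * g y).
Proof.
move=> [p pm fE] [q qn gE].
refine (ex_intro2 _ _ _ (SpherePolyTheory.deg_leM pm qn) _).
by move=> y; rewrite SpherePolyTheory.evalM fE gE.
Qed.

Lemma leq_polys {R : realType} {d m n : nat} {f : Sphere R d -> R} :
  (m <= n)%N -> polys m f -> polys n f.
Proof. by move=> mn [p pm fE]; exists p => //; exact: (leq_trans pm). Qed.

(** * Positivity of the surface measure *)

Lemma radial_projE {R : realType} {d : nat}
    (t : d.+1.-tuple (measurableTypeR R)) :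
  0 < sqnorm t ->
  val (radial_proj t) = \row_i (tnth t i / Num.sqrt (sqnorm t)).
Proof.
move=> t0; rewrite /radial_proj insubdK// inE /sphere/=.
under eq_bigr do rewrite mxE exprMn exprVn sqr_sqrtr ?ltW//.
by rewrite -mulr_suml divff// gt_eqF.
Qed.

(** Transfers neighbourhoods in the space of row vectors, which carries the
    topology, to the space of tuples, which carries the measure. *)
Lemma near_cube {R : realType} {n : nat} (v : 'rV[R]_n) (P : set 'rV[R]_n) :
  (\forall u \near v, P u) ->
  exists2 r : R, 0 < r & forall t, cube (v ord0) r t -> P (\row_i tnth t i).
Proof.
move=> /nbhs_ballP[r /= r0 rP]; exists r => // t vt; apply: rP; split => // i j.
by rewrite (ord1 i) mxE; exact: vt.
Qed.

(** The radial extension u |-> f (u / |u|) is continuous at the point y / 2,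
    which is interior to the unit ball; so it does not vanish on some cube around
    y / 2, which lies in the cone whose volume defines the surface measure. *)
Lemma surface_measure_polys_gt0 {R : realType} {d n : nat}
    {f : Sphere R d -> R} {y : Sphere R d} :
  polys n f -> f y != 0 ->
  (0 < surface_measure (f @^-1` [set~ 0%R]))%E.
Proof.
move=> pf fy0; have mf := measurable_polys pf.
have [p _ fE] := pf.
pose sq (u : 'rV[R]_d.+1) := \sum_i u 0 i ^+ 2.
pose g (u : 'rV[R]_d.+1) := mpoly.meval (fun i => u 0 i / Num.sqrt (sq u)) p.
pose v : 'rV[R]_d.+1 := 2^-1 *: val y.
have sqv : sq v = 4^-1.
  have := set_valP y; rewrite /sphere/= => y1.
  under [sq v]eq_bigr do rewrite mxE exprMn.
  rewrite -mulr_sumr y1; lra.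
have cvg_coord i : (u : 'rV[R]_d.+1) 0 i @[u --> v] --> v 0 i.
  exact: coord_continuous.
have cvg_sq : sq u @[u --> v] --> sq v.
  apply: (cvg_big _ (nbhs_filter v)) => [|i _]; first exact: add_continuous.
  exact: cvg_expr (cvg_coord i).
have gv : g v = f y.
  rewrite fE /g /SpherePoly.eval; apply: mpoly.meval_eq => i.
  rewrite sqv mxE.
  have -> : (4^-1 : R) = 2^-1 ^+ 2 by lra.
  rewrite sqrtr_sqr ger0_norm//; lra.
have cvg_g : g u @[u --> v] --> g v.
  apply: (@cvg_meval _ _ _ _ (nbhs_filter v)) => i.
  apply: cvgM => //; apply: cvgV.
    by rewrite sqv gt_eqF// sqrtr_gt0 invr_gt0.
  exact: (cvg_comp _ _ cvg_sq (@sqrt_continuous R _)).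
have [] := @near_cube R _ v [set u | 0 < sq u < 1 /\ g u != 0].
  near=> u; split.
    apply/andP; split; near: u.
      by apply: (cvgr_gt _ cvg_sq); rewrite sqv invr_gt0.
    by apply: (cvgr_lt _ cvg_sq); rewrite sqv; lra.
  by near: u; apply: (cvgr_neq0 _ cvg_g); rewrite gv.
move=> r r0 rP.
have sub : cube (v ord0) r `<=`
    @radial_proj R d @^-1` (f @^-1` [set~ 0]) `&` @punctured_ball R d.
  move=> t /rP /= [].
  have sqE : sq (\row_i tnth t i) = sqnorm t.
    by apply: eq_bigr => i _; rewrite mxE.
  rewrite sqE => /andP[t0 t1] gt0; split; last first.
    by rewrite /punctured_ball/= t0 ltW.
  rewrite /preimage/= => fu0; move/eqP: gt0; apply.
  rewrite -fu0 fE radial_projE//.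
  by apply: mpoly.meval_eq => i; rewrite sqE !mxE.
have mfn0 : measurable (f @^-1` [set~ 0]).
  rewrite -[X in measurable X]setTI; apply: mf => //.
  exact: measurableC.
rewrite /surface_measure/= /mscale/=; apply: mule_gt0; first by rewrite lte_fin.
rewrite /cone_measure /pushforward/= /mrestr.
apply: lt_le_trans (lebesgue_tuple_cube_gt0 (v ord0) r r0) _.
apply: (le_measure (lebesgue_tuple d.+1)) => //; rewrite inE.
  exact: measurable_cube.
apply: measurableI; last exact: measurable_punctured_ball.
exact: (measurable_funPTI (@radial_proj R d)).
Unshelve. all: by end_near.
Qed.

Lemma polys_sqr_integral_eq0 {R : realType} {d n : nat}
    {f : Sphere R d -> R} :
  polys n f -> (\int[@surface_measure R d]_y (f y * f y)%:E = 0)%E ->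
  forall y, f y = 0.
Proof.
move=> pf int0 y; apply/eqP; apply: contraT => fy0.
have mf := measurable_polys pf.
have := surface_measure_polys_gt0 pf fy0.
have mff : measurable_fun setT (fun z => (f z * f z)%:E).
  by apply/measurable_EFinP; exact: measurable_funM.
have : ae_eq (@surface_measure R d) setT (fun z => (f z * f z)%:E) (cst 0%E).
  apply/ae_eq_integral_abs => //.
  rewrite -int0; apply: eq_integral => z _.
  by rewrite /= ger0_norm// -expr2 sqr_ge0.
move=> [A [mA A0 subA]].
suff -> : surface_measure (f @^-1` [set~ 0]) = 0%E by rewrite ltxx.
apply: (subset_measure0 _ mA _ A0).
  rewrite -[X in measurable X]setTI; apply: mf => //.
  exact: measurableC.
move=> z fz0; apply: subA => /= /(_ I) [] /eqP.
by rewrite mulf_eq0 orbb => /eqP.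
Qed.

(** * Faithfulness of the discrete form on polynomials *)

Section nodes.
Context {R : realType} {d N : nat} (x : 'I_N -> Sphere R d) (w : 'I_N -> R).
Local Notation C := (continuousType (Sphere R d) R).
Local Notation inner := (inner x w).
Implicit Types (f g h : C) (T : C -> C).

Lemma innerBl f g h : inner (f - g) h = inner f h - inner g h.
Proof.
rewrite /inner -sumrB; apply: eq_bigr => j _.
by rewrite -mulrBl -mulrBr.
Qed.

Lemma innerBr f g h : inner f (g - h) = inner f g - inner f h.
Proof. by rewrite /inner -sumrB; apply: eq_bigr => j _; rewrite -mulrBr. Qed.

(** Exactness 2n is what f ^ 2 requires: its integral is then <f, f>_N. *)
Lemma exact_inner_eq0 {n f} :
  exactness x w (2 * n) -> polys n f -> inner f f = 0 -> f = 0.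
Proof.
move=> ex pf ff0; apply/continuousEP; apply: (polys_sqr_integral_eq0 pf).
rewrite ex; last by rewrite mul2n -addnn; exact: polysM.
congr EFin; rewrite -[RHS]ff0; apply: eq_bigr => j _.
by rewrite mulrA.
Qed.

Lemma exact_inner_inj {n f g} :
  exactness x w (2 * n) -> polys n f -> polys n g ->
  (forall h, inner f h = inner g h) -> f = g.
Proof.
move=> ex pf pg fg; apply/eqP; rewrite -subr_eq0; apply/eqP.
apply: (exact_inner_eq0 ex); first exact: polysB pf pg.
by rewrite innerBl fg subrr.
Qed.

(** Self-adjointness moves T to the second argument of the form, so that the
    first one is linear in f and g; faithfulness then removes the form. *)
Lemma self_adjointB {n T} :
  exactness x w (2 * n) -> (forall f, polys n (T f)) ->
  hyper_self_adjoint x w T -> {morph T : f g / f - g}.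
Proof.
move=> ex pT sT f g; apply: (exact_inner_inj ex) => [//||h].
  exact: polysB (pT f) (pT g).
by rewrite innerBl !sT innerBl.
Qed.

End nodes.

(** * Differences of projections *)

Theorem theorem4p3 (R : realType) (d : nat) (hd : (2 <= d)%N)
    (Z : nat -> nat) (Y : forall l, 'I_(Z l) -> continuousType (Sphere R d) R)
    (hY : orthonormal_basis Y)
    (N : nat) (x : 'I_N -> Sphere R d) (w : 'I_N -> R)
    (hw : forall j, 0 < w j)
    (T1 T2 : continuousType (Sphere R d) R -> continuousType (Sphere R d) R)
    (hT1 : hyper_class x w Y T1) (hT2 : hyper_class x w Y T2)
    (hP1 : hyper_projection x w T1) (hP2 : hyper_projection x w T2) :
  hyper_projection x w (T2 \- T1) <-> suboperator T1 T2.
Proof.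
have [n [ex p1 p2]] : exists n : nat, [/\ exactness x w (2 * n),
    forall f, polys n (T1 f) & forall f, polys n (T2 f)].
  have [n1 [ex1 p1 _ _]] := hT1; have [n2 [ex2 p2 _ _]] := hT2.
  have [n12|/ltnW n21] := leqP n1 n2.
    by exists n2; split=> // f; exact: leq_polys (p1 f).
  by exists n1; split=> // f; exact: leq_polys (p2 f).
have [s1 /funeqP T1K] := hP1; have [s2 /funeqP T2K] := hP2.
have subE (f g : continuousType (Sphere R d) R) y : (f - g) y = f y - g y by [].
have B1 := self_adjointB _ _ ex p1 s1.
have B2 := self_adjointB _ _ ex p2 s2.
split.
- move=> [_ /funeqP idem] _ [f _ <-].
  (* T1 T2 + T2 T1 = 2 T1, written with differences, which T1 respects. *)
  have anti g : T1 (T2 g) - T1 g = T1 g - T2 (T1 g).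
    have /continuousEP idemg := idem g.
    have /continuousEP := T1K g; have /continuousEP := T2K g => /= e2 e1.
    apply/continuousEP => y; have := idemg y; rewrite /= B1 B2 !subE.
    by rewrite e1 e2; lra.
  (* T1 f is its own image under T2. With t, A, B, C the values of
     T1 f, T1 (T2 f), T2 (T1 f) and T1 (T2 (T1 f)), the three equations below
     read A + C = 2 t, A + B = 2 t and C + B = 2 t, whence B = t. *)
  exists (T1 f) => //.
  have anti1 := congr1 T1 (anti f).
  have := anti (T1 f).
  have := anti f.
  move: anti1; rewrite !B1.
  have := T1K f; have := T1K (T2 f); rewrite /= => -> ->.
  move=> /continuousEP h1 /continuousEP h2 /continuousEP h3.
  apply/continuousEP => y; have := h1 y; have := h2 y; have := h3 y.
  rewrite !subE; lra.
- move=> sub.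
  have T21 f : T2 (T1 f) = T1 f.
    have [g _ <-] := sub _ (ex_intro2 _ _ f I erefl).
    exact: T2K.
  have T12 f : T1 (T2 f) = T1 f.
    apply: (exact_inner_inj _ _ ex) => // h.
    by rewrite s1 s2 T21 s1.
  split=> [f g|].
    by rewrite innerBl innerBr s1 s2.
  apply/funext => f /=.
  have := T1K f; have := T2K f; rewrite /= => e1 e2.
  by rewrite B1 B2 e1 e2 T12 T21 subrr subr0.
Qed.
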